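(* Let $c:\mathbb{R}^n\to\mathbb{R}^m$ be $C^1$-smooth with Lipschitz continuous $\nabla c$, and let $h:\mathbb{R}^m\to\mathbb{R}$ be convex and $L$-Lipschitz continuous with $\inf_y h(y)>-\infty$. For $x\in\mathbb{R}^n$ and $\epsilon>0$ define $$G(x,\epsilon)=\Big\{\nabla c(x)\,y\ \Big|\ y\in\operatorname{argmax}_{y\in\operatorname{dom}(h^* )}\big\{y^\top c(x)-h^*(y)-\tfrac{\epsilon}{2}\|\nabla c(x)\,y\|^2\big\}\Big\}.$$ Then the prox-linear update with stepsize $\epsilon$ for minimizing $h(c(x))$ is equivalent to the update $x^{k+1}=x^k-\epsilon\,G(x^k,\epsilon)$; that is, for every $x^k\in\mathbb{R}^n$ and every $\epsilon>0$, $$\operatorname{argmin}_{z\in\mathbb{R}^n}\Big\{h\big(c(x^k)+\nabla c(x^k)^\top(z-x^k)\big)+\frac{1}{2\epsilon}\|z-x^k\|^2\Big\}=x^k-\epsilon\,G(x^k,\epsilon),$$ where the left-hand side is a single point.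
   Context: $\nabla c(x)\in\mathbb{R}^{n\times m}$ denotes the transpose of the Jacobian matrix of $c$ at $x$; $h^*$ is the convex conjugate of $h$ with effective domain $\operatorname{dom}(h^* )$; $\|\cdot\|$ is the Euclidean norm. *)

(* Defs.v *)
From HB Require Import structures.
From mathcomp Require Import all_boot all_order all_algebra.
From mathcomp Require Import all_classical all_reals all_analysis.
Import Order.TTheory GRing.Theory Num.Theory.
Import numFieldNormedType.Exports.

Set Implicit Arguments.
Unset Strict Implicit.
Unset Printing Implicit Defensive.

Local Open Scope classical_set_scope.
Local Open Scope ring_scope.

(* Points of R^n are row vectors 'rV[R]_n, so a product
   M w with a column vector w is written w *m M^T. *)

Section Euclidean.
Context {R : realType} {n : nat}.

Definition dot (u v : 'rV[R]_n) : R := (u *m v^T) 0 0.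

(* The library norm `|u| on matrices is the sup norm, not this one. *)
Definition enorm (u : 'rV[R]_n) : R := Num.sqrt (dot u u).

End Euclidean.

Section Optimization.
Context {T : Type} {d : Order.disp_t} {O : porderType d}.

Definition argmin (A : set T) (f : T -> O) : set T :=
  [set x | A x /\ forall z, A z -> (f x <= f z)%O].

Definition argmax (A : set T) (f : T -> O) : set T :=
  [set x | A x /\ forall z, A z -> (f z <= f x)%O].

End Optimization.

Section Conjugate.
Context {R : realType} {m : nat}.

Definition conjugate (h : 'rV[R]_m -> R) (y : 'rV[R]_m) : \bar R :=
  ereal_sup [set (dot y w - h w)%:E | w in [set: 'rV[R]_m]].

Definition dom (g : 'rV[R]_m -> \bar R) : set 'rV[R]_m :=
  [set y | (g y < +oo)%E].

End Conjugate.

Section ProxLinear.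
Context {R : realType} {n m : nat}.

(* In the row-vector convention 'J c x has entries (i, j) |-> d c_j / d x_i:
   it is already the transpose of the textbook Jacobian matrix. *)
Definition grad (c : 'rV[R]_n -> 'rV[R]_m) (x : 'rV[R]_n) : 'M[R]_(n, m) :=
  'J c x.

(* On matrices, the library's topology and [lipschitz] are those of the sup
   norm; being Lipschitz for some constant does not depend on the norm. *)
Definition C1_lipschitz_grad (c : 'rV[R]_n -> 'rV[R]_m) : Prop :=
  [/\ forall x, differentiable c x, continuous (grad c) & lipschitz (grad c)].

Definition dual_objective (c : 'rV[R]_n -> 'rV[R]_m) (h : 'rV[R]_m -> R)
    (x : 'rV[R]_n) (eps : R) (y : 'rV[R]_m) : \bar R :=
  ((dot y (c x))%:E - conjugate h y
     - (eps / 2 * enorm (y *m (grad c x)^T) ^+ 2)%:E)%E.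

Definition G (c : 'rV[R]_n -> 'rV[R]_m) (h : 'rV[R]_m -> R)
    (x : 'rV[R]_n) (eps : R) : set 'rV[R]_n :=
  [set y *m (grad c x)^T |
     y in argmax (dom (conjugate h)) (dual_objective c h x eps)].

Definition prox_linear (c : 'rV[R]_n -> 'rV[R]_m) (h : 'rV[R]_m -> R)
    (x : 'rV[R]_n) (eps : R) : set 'rV[R]_n :=
  argmin [set: 'rV[R]_n] (fun z =>
    h (c x + (z - x) *m grad c x) + (2 * eps)^-1 * enorm (z - x) ^+ 2).

End ProxLinear.

(* Main.v *)
Require Import Defs.
From mathcomp Require Import all_boot all_order all_algebra.
From mathcomp Require Import all_classical all_reals all_analysis.
From mathcomp Require Import ring lra.
Import Order.TTheory GRing.Theory Num.Theory.
Import numFieldNormedType.Exports.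
Local Open Scope classical_set_scope.
Local Open Scope ring_scope.

(** Write b = c(x), A for the transposed Jacobian and w(y) = b - eps y A^T A.
The theorem follows once some y is a subgradient of h at w(y), the point
reached when the step z = x - eps y A^T is taken in the linearised model.
Such a y certifies optimality on both sides by completing squares:
- the subgradient inequality at w(y) shows that the primal objective at any z'
  exceeds its value at z by at least |z' - z|^2 / (2 eps), so z is the only
  minimiser ([prox_linear_of_subgradient]);
- equality holds in the Fenchel-Young inequality for y and w(y), so the dual
  objective at any y' is below its value at y by at least
  eps/2 |y' A^T - y A^T|^2.  Hence y is a dual maximiser, and although others
  may exist they all have the same image y A^T ([G_of_subgradient]).

The existence of y ([dual_solution_exists]) is a chain rule for
subdifferentials, obtained here from compactness alone, with no separation
theorem.  Replace the linear map s |-> s A by the surjective one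
(s, r) |-> s A + d r with d > 0.  The regularised problem has a minimiser
because h is bounded below, and its first-order condition, tested separately
on the kernel of this map and on the second block, gives a subgradient y at
w(y) - eps d^2 y ([perturbed_dual_solution]).  Subgradients of a Lipschitz
function are bounded, so these y have a cluster point as d tends to 0, and
the subgradient inequality passes to the limit since both of its sides are
continuous in y. *)

(** * The Euclidean inner product on row vectors *)

Section DotTheory.
Context {R : realType} {n : nat}.
Implicit Types u v w : 'rV[R]_n.

Lemma dotE u v : dot u v = \sum_i u 0 i * v 0 i.
Proof. by rewrite /dot mxE; apply: eq_bigr => i _; rewrite mxE. Qed.

Lemma dotC u v : dot u v = dot v u.
Proof. by rewrite !dotE; apply: eq_bigr => i _; rewrite mulrC. Qed.

Lemma dotDl u v w : dot (u + v) w = dot u w + dot v w.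
Proof. by rewrite /dot mulmxDl mxE. Qed.

Lemma dotZl (a : R) u v : dot (a *: u) v = a * dot u v.
Proof. by rewrite /dot -scalemxAl mxE. Qed.

Lemma dotNl u v : dot (- u) v = - dot u v.
Proof. by rewrite -scaleN1r dotZl mulN1r. Qed.

Lemma dotDr u v w : dot u (v + w) = dot u v + dot u w.
Proof. by rewrite !(dotC u) dotDl. Qed.

Lemma dotZr (a : R) u v : dot u (a *: v) = a * dot u v.
Proof. by rewrite !(dotC u) dotZl. Qed.

Lemma dotNr u v : dot u (- v) = - dot u v.
Proof. by rewrite !(dotC u) dotNl. Qed.

Lemma dot0r u : dot u 0 = 0.
Proof. by rewrite -(scale0r u) dotZr mul0r. Qed.

Lemma dot_ge0 u : 0 <= dot u u.
Proof. by rewrite dotE; apply: sumr_ge0 => i _; rewrite -expr2 sqr_ge0. Qed.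

Lemma dot_eq0 u : (dot u u == 0) = (u == 0).
Proof.
apply/eqP/eqP => [|->]; last exact: dot0r.
rewrite dotE => /eqP; rewrite psumr_eq0 => [/allP u0|i _]; last first.
  by rewrite -expr2 sqr_ge0.
apply/rowP => i; rewrite mxE; apply/eqP.
by have := u0 i (mem_index_enum i); rewrite -expr2 sqrf_eq0.
Qed.

Lemma sqr_enorm u : enorm u ^+ 2 = dot u u.
Proof. by rewrite sqr_sqrtr // dot_ge0. Qed.

Lemma enorm_ge0 u : 0 <= enorm u.
Proof. exact: sqrtr_ge0. Qed.

Lemma enormZ (a : R) u : enorm (a *: u) = `|a| * enorm u.
Proof.
by rewrite /enorm dotZl dotZr mulrA -expr2 sqrtrM ?sqr_ge0// sqrtr_sqr.
Qed.

(** Closed sup-norm balls are the compact sets used below, whereas growth and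
    bounds are measured in the Euclidean norm. *)
Lemma norm_le_enorm u : `|u| <= enorm u.
Proof.
rewrite [leLHS]/Num.norm /= mx_normrE; apply: bigmax_le => [|[i j] _ /=].
  exact: enorm_ge0.
rewrite [i]ord1 -sqrtr_sqr ler_sqrt ?dot_ge0// dotE (bigD1 j)//= expr2 lerDl.
by apply: sumr_ge0 => k _; rewrite -expr2 sqr_ge0.
Qed.

End DotTheory.

Lemma dot_mulmx {R : realType} {n m : nat} (u : 'rV[R]_n) (A : 'M[R]_(n, m))
  (y : 'rV[R]_m) : dot (u *m A) y = dot u (y *m A^T).
Proof. by rewrite /dot trmx_mul trmxK mulmxA. Qed.

Lemma dot_row_mx {R : realType} {n m : nat} (u v : 'rV[R]_n) (p q : 'rV[R]_m) :
  dot (row_mx u p) (row_mx v q) = dot u v + dot p q.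
Proof. by rewrite /dot tr_row_mx mul_row_col mxE. Qed.

(** * Continuity, convexity and compactness *)

Lemma dot_continuous {R : realType} {n : nat} {T : topologicalType}
  (f g : T -> 'rV[R]_n) :
  continuous f -> continuous g -> continuous (fun t => dot (f t) (g t)).
Proof.
move=> cf cg; under eq_fun do rewrite dotE.
have ccoord (k : T -> 'rV[R]_n) i :
    continuous k -> continuous (fun t => k t 0 i).
  move=> ck t; exact: (@continuous_comp _ _ _ k (fun M : 'rV[R]_n => M 0 i) t
    (ck t) (@coord_continuous R 1 n 0 i (k t))).
apply: continuous_big => [|i _ t]; first exact: (@add_continuous R^o).
by apply: cvgM; [exact: (ccoord f i cf)|exact: (ccoord g i cg)].
Qed.

Lemma mulmxr_continuous {R : realType} {n m : nat} (A : 'M[R]_(n, m)) :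
  continuous (fun u : 'rV[R]_n => u *m A).
Proof.
have cZ i : continuous (fun u : 'rV[R]_n => u 0 i *: row i A).
  move=> u; apply: (@cvgZ R 'rV[R]_m _ (nbhs u)); last exact: cvg_cst.
  exact: coord_continuous.
under eq_fun do rewrite mulmx_sum_row.
by apply: continuous_big => [|i _]; [exact: add_continuous|exact: cZ].
Qed.

Lemma enorm_lipschitz_continuous {R : realType} {m : nat}
  (h : 'rV[R]_m -> R) (L : R) :
  (forall u v, `|h u - h v| <= L * enorm (u - v)) -> continuous h.
Proof.
move=> hlip u; apply/(@cvgrPdist_le _ R^o _ (nbhs u)) => e e0.
have cs : continuous (fun v : 'rV[R]_m => u - v).
  move=> v; apply: (@cvgB _ 'rV[R]_m _ (nbhs v)); first exact: cvg_cst.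
  exact: cvg_id.
have ce : continuous (fun v : 'rV[R]_m => enorm (u - v)).
  move=> v; have cd := dot_continuous _ _ cs cs v.
  exact: (@continuous_comp _ _ _ _ Num.sqrt _ cd (@sqrt_continuous R _)).
have c : continuous (fun v : 'rV[R]_m => L * enorm (u - v)).
  by move=> v; apply: (@cvgM R _ (nbhs v)); [exact: cvg_cst|exact: ce].
have /(@cvgrPdist_le _ R^o _ (nbhs u)) /(_ e e0) := c u.
apply: filterS => v; rewrite subrr /enorm dot0r sqrtr0 mulr0 sub0r normrN.
by move=> /(le_trans (ler_norm _)); apply: le_trans.
Qed.

(** Convexity along a segment issued from [u], in the increment form used to
    differentiate at [t = 0]. *)
Lemma convex_functionE {R : realType} {m : nat} (h : 'rV[R]_m -> R) :
  convex_function [set: 'rV[R]_m] h ->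
  forall (t : R) (u v : 'rV[R]_m), 0 <= t <= 1 ->
  h (u + t *: v) <= h u + t * (h (u + v) - h u).
Proof.
move=> hconv t u v /andP[t0 t1].
have -> : u + t *: v = t *: (u + v) + (1 - t) *: u.
  by rewrite scalerDr scalerBl scale1r [RHS]addrC addrA subrK.
have -> : h u + t * (h (u + v) - h u) = t * h (u + v) + (1 - t) * h u by ring.
by apply: (hconv (Itv01 t0 t1)); rewrite inE.
Qed.

Lemma norm_ball_compact {R : realType} {n : nat} (r : R) :
  compact [set u : 'rV[R]_n | `|u| <= r].
Proof.
apply: bounded_closed_compact.
  exists r; split; first exact: num_real.
  by move=> x rx s /= /le_trans; apply; exact: ltW.
apply: (@closed_comp _ _ (fun s : 'rV[R]_n => `|s|) [set x | x <= r]).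
  by move=> s _; exact: norm_continuous.
exact: closed_le.
Qed.

Lemma le0_of_le_small_mul {R : realFieldType} (a B : R) : 0 <= B ->
  (forall l, 0 < l <= 1 -> a <= l * B) -> a <= 0.
Proof.
move=> B0 aB; rewrite leNgt; apply/negP => a0.
have d0 : 0 < a + B + 1 by lra.
have : a <= a / (a + B + 1) * B.
  by apply: aB; rewrite divr_gt0//= ler_pdivrMr// mul1r; lra.
rewrite mulrAC ler_pdivlMr// ler_pM2l//; lra.
Qed.

(** * The regularised convex problem *)

Section ProxSubproblem.
Context {R : realType} {n m : nat}.
Context (h : 'rV[R]_m -> R) (A : 'M[R]_(n, m)) (b : 'rV[R]_m) (eps : R).
Context (eps0 : 0 < eps).

Definition prox_objective (s : 'rV[R]_n) : R :=
  h (b + s *m A) + (2 * eps)^-1 * dot s s.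

Lemma prox_objective_min_exists (C : R) : continuous h ->
  (forall w, C <= h w) ->
  exists s, forall t, prox_objective s <= prox_objective t.
Proof.
move=> ch hC.
have cphi : continuous prox_objective.
  have cA : continuous (fun s : 'rV[R]_n => b + s *m A).
    move=> s; apply: (@cvgD _ 'rV[R]_m _ (nbhs s)); first exact: cvg_cst.
    exact: mulmxr_continuous.
  have cid : continuous (fun s : 'rV[R]_n => s) by move=> s; exact: cvg_id.
  move=> s; apply: (@cvgD _ R^o _ (nbhs s)).
    exact: (@continuous_comp _ _ _ _ h s (cA s) (ch _)).
  apply: (@cvgM R _ (nbhs s)); first exact: cvg_cst.
  exact: (dot_continuous _ _ cid cid s).
(* Outside the ball of radius [r] the quadratic term is at least [h b - C],
   so the objective is no smaller there than at the origin; the summand [1]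
   ensures [r <= r ^+ 2]. *)
pose r := 1 + 2 * eps * (h b - C).
have hb := hC b.
have r1 : 1 <= r by rewrite /r lerDl mulr_ge0 ?subr_ge0 ?mulr_ge0 ?(ltW eps0).
pose K := [set s : 'rV[R]_n | `|s| <= r].
have K0 : K 0 by rewrite /K/= normr0; lra.
have cK : compact K by exact: norm_ball_compact.
have [s sK smin] := @EVT_min_rV R n prox_objective K (ex_intro _ 0 K0) cK
  (continuous_subspaceT cphi).
exists s => t; have [tr|rt] := leP `|t| r.
  by apply: smin; rewrite inE.
apply: (@le_trans _ _ (prox_objective 0)); first by apply: smin; rewrite inE.
rewrite /prox_objective mul0mx addr0 dot0r mulr0 addr0.
have := hC (b + t *m A); set ht := h _ => Cht.
suff : h b - C <= (2 * eps)^-1 * dot t t by lra.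
rewrite mulrC ler_pdivlMr ?mulr_gt0// -sqr_enorm.
have rE : r <= enorm t by rewrite (le_trans (ltW rt))// norm_le_enorm.
have : r * 1 <= enorm t * enorm t by rewrite ler_pM//; lra.
rewrite expr2 mulr1 {1}/r; lra.
Qed.

(** The first-order condition of the minimiser [s], in a form free of
    derivatives of [h]: compare [s] with [s + l *: t], bound [h] by convexity,
    divide by [l] and let [l] tend to [0]; the remainder [l * |t|^2 / (2 eps)]
    vanishes. *)
Lemma prox_objective_min_variational (s : 'rV[R]_n) :
  convex_function [set: 'rV[R]_m] h ->
  (forall t, prox_objective s <= prox_objective t) ->
  forall t, h (b + s *m A) - eps^-1 * dot s t <= h (b + (s + t) *m A).
Proof.
move=> hconv smin t; rewrite -subr_le0.
apply: (@le0_of_le_small_mul _ _ ((2 * eps)^-1 * dot t t)).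
  by rewrite mulr_ge0 ?dot_ge0// invr_ge0 mulr_ge0 ?(ltW eps0).
move=> l /andP[l0 l1].
have l01 : 0 <= l <= 1 by rewrite (ltW l0).
have := smin (s + l *: t); rewrite /prox_objective.
have := convex_functionE h hconv l (b + s *m A) (t *m A) l01.
rewrite scalemxAl -!addrA -!mulmxDl.
rewrite dotDl !dotDr !dotZl !dotZr (dotC t s) invfM.
set p := h (b + (s + l *: t) *m A); set q := h (b + (s + t) *m A).
set h0 := h (b + s *m A) => H1 H2.
rewrite -(ler_pM2l l0).
set st := dot s t in H2 *; set ss := dot s s in H2; set tt := dot t t in H2 *.
move: (eps^-1) H1 H2 => e H1 H2.
lra.
Qed.

End ProxSubproblem.

(** * Subgradients and the existence of a dual solution *)

Section Subgradients.
Context {R : realType} {m : nat} (h : 'rV[R]_m -> R).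

Definition subdifferential (w : 'rV[R]_m) : set 'rV[R]_m :=
  [set y | forall v, h w + dot y (v - w) <= h v].

(** Test the subgradient inequality at [w + y]: it gives
    [|y|^2 <= L * |y|].  The bound is by [`|L|] because [L] may be negative
    when [m = 0]. *)
Lemma subgradient_enorm_le (L : R) (w y : 'rV[R]_m) :
  (forall u v, `|h u - h v| <= L * enorm (u - v)) ->
  subdifferential w y -> enorm y <= `|L|.
Proof.
move=> hlip /(_ (w + y)); have := hlip (w + y) w.
rewrite addrAC subrr add0r -sqr_enorm => /(le_trans (ler_norm _)) hL hy.
have [y0|yN0] := eqVneq (enorm y) 0; first by rewrite y0 normr_ge0.
have y0 : 0 < enorm y by rewrite lt_neqAle eq_sym yN0 enorm_ge0.
rewrite -(ler_pM2r y0) -expr2.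
have : L * enorm y <= `|L| * enorm y by rewrite ler_pM2r// ler_norm.
lra.
Qed.

(** With [B := col_mx A d%:M] the affine map [z |-> b + z *m B] is onto, so the
    first-order condition of the minimiser [row_mx s r] controls [h] in every
    direction and can be read as a subgradient inequality. *)
Lemma perturbed_dual_solution {n : nat} (A : 'M[R]_(n, m)) (b : 'rV[R]_m)
  (eps d C : R) : 0 < eps -> 0 < d -> continuous h -> (forall w, C <= h w) ->
  convex_function [set: 'rV[R]_m] h ->
  exists y, subdifferential
    (b - eps *: (y *m A^T *m A) - (eps * d ^+ 2) *: y) y.
Proof.
move=> eps0 d0 ch hC hconv.
have dN0 : d != 0 by rewrite gt_eqF.
have epsN0 : eps != 0 by rewrite gt_eqF.
pose B := col_mx A (d%:M : 'M[R]_m).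
have BE (s : 'rV[R]_n) (r : 'rV[R]_m) : row_mx s r *m B = s *m A + d *: r.
  by rewrite mul_row_col mul_mx_scalar.
have [z zmin] := prox_objective_min_exists h B b eps eps0 C ch hC.
have {zmin} := prox_objective_min_variational h B b eps eps0 z hconv zmin.
rewrite -[z]hsubmxK; move: (lsubmx z) (rsubmx z) => s r {z} V.
pose y := - (eps * d)^-1 *: r.
(* Along the kernel of [B] the value of [h] does not change, so [row_mx s r]
   is orthogonal to this kernel; the kernel vector built from the defect [e]
   itself then gives [|e|^2 <= 0]. *)
have sE : s = - eps *: (y *m A^T).
  pose e := s - d^-1 *: (r *m A^T).
  have := V (row_mx (- e) (d^-1 *: (e *m A))).
  rewrite dot_row_mx add_row_mx !BE scalerDr scalerA divff// scale1r.
  rewrite (mulmxBl s e) addrACA addNr addr0.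
  have -> : dot s (- e) + dot r (d^-1 *: (e *m A)) = - dot e e.
    rewrite dotZr (dotC r) dot_mulmx -dotZr.
    rewrite (_ : d^-1 *: (r *m A^T) = s - e); last by rewrite opprB subrKC.
    rewrite dotDr !dotNr (dotC s); ring.
  rewrite mulrN opprK gerDl => e0.
  have {}e0 : e == 0.
    rewrite -dot_eq0 eq_le dot_ge0 andbT.
    by rewrite -(pmulr_rle0 _ (_ : 0 < eps^-1)) ?invr_gt0.
  apply/eqP; rewrite -subr_eq0; move: e0; rewrite /e /y.
  by rewrite -scalemxAl scalerA invfM mulrNN mulrA divff// mul1r.
exists y => v.
have wE : b - eps *: (y *m A^T *m A) - (eps * d ^+ 2) *: y
    = b + row_mx s r *m B.
  rewrite BE sE -(scalemxAl (- eps)) (scaleNr eps) addrA; congr (_ + _).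
  rewrite /y scalerA -scaleNr; congr (_ *: _); field.
  by rewrite epsN0 dN0.
rewrite wE; set w := b + _.
(* Variations of the second block alone reach every point [v]. *)
have := V (row_mx 0 (d^-1 *: (v - w))).
rewrite dot_row_mx dot0r add0r mulmxDl addrA -/w (BE 0) mul0mx add0r.
rewrite scalerA divff// scale1r subrKC; apply: le_trans.
rewrite lerD2l /y dotZl dotZr mulrA mulNr.
by rewrite invfM.
Qed.

(** The chain rule behind strong duality: [y] is a maximiser of the dual
    objective and the argument of [subdifferential] is the point where the
    optimal primal step lands. *)
Lemma dual_solution_exists {n : nat} (A : 'M[R]_(n, m)) (b : 'rV[R]_m)
  (eps C L : R) : 0 < eps -> (forall w, C <= h w) ->
  (forall u v, `|h u - h v| <= L * enorm (u - v)) ->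
  convex_function [set: 'rV[R]_m] h ->
  exists y, subdifferential (b - eps *: (y *m A^T *m A)) y.
Proof.
move=> eps0 hC hlip hconv.
have ch := enorm_lipschitz_continuous h L hlip.
have d0 k : 0 < harmonic k :> R by exact: harmonic_gt0.
have [y_ yP] := choice (fun k =>
  perturbed_dual_solution A b eps _ C eps0 (d0 k) ch hC hconv).
pose w y := b - eps *: (y *m A^T *m A).
pose gap v y := h (w y) + dot y (v - w y) - h v.
have cgap v : continuous (gap v).
  have cid : continuous (fun y : 'rV[R]_m => y) by move=> y; exact: cvg_id.
  have cM : continuous (fun y : 'rV[R]_m => y *m A^T *m A).
    under eq_fun do rewrite -mulmxA; exact: mulmxr_continuous.
  have cw : continuous w.
    move=> y; apply: (@cvgB _ 'rV[R]_m _ (nbhs y)); first exact: cvg_cst.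
    apply: (@cvgZ R 'rV[R]_m _ (nbhs y)); first exact: cvg_cst.
    exact: cM.
  have cvw : continuous (fun y => v - w y).
    move=> y; apply: (@cvgB _ 'rV[R]_m _ (nbhs y)); first exact: cvg_cst.
    exact: cw.
  move=> y; apply: (@cvgB _ R^o _ (nbhs y)); last exact: cvg_cst.
  apply: (@cvgD _ R^o _ (nbhs y)); last exact: (dot_continuous _ _ cid cvw).
  exact: (@continuous_comp _ _ _ w h y (cw y) (ch _)).
(* [y_ k] is a subgradient at a point at distance [eps * d ^+ 2 * |y_ k|] from
   [w (y_ k)], where [d] is [harmonic k].  Moving the base point to [w (y_ k)]
   costs an error that is uniform in [v]. *)
have y_bnd k : enorm (y_ k) <= `|L| by exact: subgradient_enorm_le hlip (yP k).
have gap_le v k : gap v (y_ k) <= harmonic k * (eps * L ^+ 2).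
  have := yP k v; rewrite -/(w _) /gap; set y := y_ k; set a := eps * _.
  have a0 : 0 <= a by rewrite mulr_ge0 ?sqr_ge0// ltW.
  rewrite opprB addrCA dotDr dotZr -sqr_enorm => yv.
  have := hlip (w y) (w y - a *: y).
  rewrite opprB subrKC enormZ (ger0_norm a0) => /(le_trans (ler_norm _)) hw.
  have : L * (a * enorm y) <= a * L ^+ 2.
    rewrite mulrCA ler_wpM2l// -real_normK ?num_real// expr2.
    apply: (le_trans (ler_wpM2r (enorm_ge0 _) (ler_norm L))).
    by rewrite ler_wpM2l//; exact: y_bnd.
  have : 0 <= a * enorm y ^+ 2 by rewrite mulr_ge0// sqr_ge0.
  have : a * L ^+ 2 <= harmonic k * (eps * L ^+ 2).
    have -> : a * L ^+ 2 = harmonic k * (harmonic k * (eps * L ^+ 2)).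
      by rewrite /a; ring.
    have eL0 : 0 <= eps * L ^+ 2 by rewrite mulr_ge0 ?sqr_ge0 ?(ltW eps0).
    by rewrite ler_pM2l// ler_piMl// /harmonic/= invf_le1 ?ler1n.
  by lra.
pose K := [set y : 'rV[R]_m | `|y| <= `|L|].
have cK : compact K by exact: norm_ball_compact.
have FK : (y_ @ \oo) K.
  by exists 0%N => // k _; exact: le_trans (norm_le_enorm _) (y_bnd k).
have [p [_ pcl]] := cK _ _ FK.
exists p => v; rewrite -/(w p) -subr_le0 -/(gap v p) leNgt; apply/negP => gap0.
have near_p : nbhs p [set y | gap v p / 2 < gap v y].
  by apply: (@cvgr_gt _ _ (nbhs p) _ (gap v) (gap v p) (cgap v p)); lra.
have near_oo : (y_ @ \oo) [set y | gap v y <= gap v p / 2].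
  have : harmonic k * (eps * L ^+ 2) @[k --> \oo] --> (0 * (eps * L ^+ 2) : R).
    by apply: cvgM; [exact: cvg_harmonic|exact: cvg_cst].
  rewrite mul0r => /cvgr_lt /(_ (gap v p / 2)); rewrite divr_gt0// => /(_ isT).
  by apply: filterS => k /ltW; apply: le_trans; exact: gap_le.
have [y [/= y1 y2]] := pcl _ _ near_oo near_p.
by move: (lt_le_trans y2 y1); rewrite ltxx.
Qed.

End Subgradients.

(** * Both sides of the update, computed from a dual solution *)

Section DualCertificate.
Context {R : realType} {n m : nat}.
Context (c : 'rV[R]_n -> 'rV[R]_m) (h : 'rV[R]_m -> R).
Context (x : 'rV[R]_n) (eps : R) (y : 'rV[R]_m).
Context (eps0 : 0 < eps).
Context (yP : subdifferential h
  (c x - eps *: (y *m (grad c x)^T *m grad c x)) y).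

(** The linear term of the subgradient inequality, [dot t g] for a
    displacement [t], cancels the cross term of [|t - eps *: g|^2 / (2 eps)],
    leaving the quadratic growth that gives optimality and uniqueness. *)
Lemma prox_linear_of_subgradient :
  prox_linear c h x eps = [set x - eps *: (y *m (grad c x)^T)].
Proof.
rewrite /prox_linear; set A := grad c x; set g := y *m A^T.
set f := fun z => _.
have epsN0 : eps != 0 by rewrite gt_eqF.
have growth z : f (x - eps *: g) +
    (2 * eps)^-1 * dot (z - (x - eps *: g)) (z - (x - eps *: g)) <= f z.
  rewrite /f; set t := z - (x - eps *: g).
  have -> : z - x = t - eps *: g by rewrite /t opprB addrA addrAC addrK.
  have -> : x - eps *: g - x = - (eps *: g) by rewrite addrAC subrr add0r.
  clearbody t.
  rewrite mulNmx mulmxBl -!scalemxAl !sqr_enorm.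
  have := yP (c x + (t *m A - eps *: (g *m A))).
  rewrite addrCA addrK (dotC y) dot_mulmx -/g.
  set h1 := h _; set h2 := h _ => h12.
  rewrite !(dotDl, dotDr, dotNl, dotNr, dotZl, dotZr) (dotC g t).
  rewrite (_ : h1 + _ + _ = h1 + dot t g + (2 * eps)^-1 *
    (dot t t - 2 * eps * dot t g + eps ^+ 2 * dot g g)); last by field.
  rewrite (_ : dot t t - _ + _ =
    dot t t - 2 * eps * dot t g + eps ^+ 2 * dot g g); last by ring.
  by rewrite lerD2r.
have ie0 : 0 < (2 * eps)^-1 by rewrite invr_gt0 mulr_gt0.
apply/seteqP; split => z /=.
  move=> [_ /(_ (x - eps *: g) I)] /(le_trans (growth z)).
  rewrite gerDl pmulr_rle0// => t0.
  by apply/eqP; rewrite -subr_eq0 -dot_eq0 eq_le t0 dot_ge0.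
move=> ->; split=> // t _; apply: le_trans (growth t).
by rewrite lerDl mulr_ge0 ?dot_ge0// ltW.
Qed.

(** Fenchel-Young is an equality at [y] and [w], so bounding the conjugate by
    [dot v w - h w] is exact at [v = y]; the resulting quadratic upper bound on
    the dual objective depends on [v] only through [v *m A^T]. *)
Lemma G_of_subgradient : G c h x eps = [set y *m (grad c x)^T].
Proof.
rewrite /G; set A := grad c x; set g := y *m A^T.
set D := dual_objective c h x eps.
pose w := c x - eps *: (g *m A).
have dot_w u : dot u w = dot u (c x) - eps * dot (u *m A^T) g.
  by rewrite /w dotDr dotNr dotZr (dotC u (g *m A)) dot_mulmx (dotC g).
have conj_ge v : ((dot v w - h w)%:E <= conjugate h v)%E.
  by apply: ereal_sup_ubound; exists w.
have conj_y : conjugate h y = (dot y w - h w)%:E.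
  apply/le_anti/andP; split; last exact: conj_ge.
  apply: ge_ereal_sup => _ [v _ <-]; rewrite lee_fin.
  by have := yP v; rewrite -/A -/g -/w dotDr dotNr; lra.
have decay v : dom (conjugate h) v ->
    (D v + (eps / 2 * dot (v *m A^T - g) (v *m A^T - g))%:E <= D y)%E.
  rewrite /dom /D /dual_objective /= conj_y; have := conj_ge v.
  case: (conjugate h v) => [r| |]//=; rewrite lee_fin => rv _.
  rewrite -!EFinB -EFinD lee_fin -/A -/g !sqr_enorm.
  move: rv; rewrite !dot_w -/g; move: (v *m A^T) => p.
  rewrite !(dotDl, dotDr, dotNl, dotNr) (dotC g p).
  by lra.
have yD : argmax (dom (conjugate h)) D y.
  split; first by rewrite /dom/= conj_y ltry.
  move=> v /decay; apply: le_trans; rewrite leeDl// lee_fin.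
  by rewrite mulr_ge0 ?dot_ge0// divr_ge0// ltW.
apply/seteqP; split => [_ [v [vdom vmax] <-]|_ ->]; last by exists y.
have := le_trans (decay _ vdom) (vmax _ yD.1).
have vfin : D v \is a fin_num.
  move: vdom (conj_ge v); rewrite /dom /D /dual_objective /=.
  by case: (conjugate h v).
rewrite -(fineK vfin) -EFinD lee_fin gerDl pmulr_rle0 ?divr_gt0// => t0.
by apply/eqP; rewrite -subr_eq0 -dot_eq0 eq_le t0 dot_ge0.
Qed.

End DualCertificate.

Theorem proposition7 (R : realType) (n m : nat)
    (c : 'rV[R]_n -> 'rV[R]_m) (h : 'rV[R]_m -> R) (L : R)
    (hc : C1_lipschitz_grad c)
    (hconv : convex_function [set: 'rV[R]_m] h)
    (hlip : forall u v : 'rV[R]_m, `|h u - h v| <= L * enorm (u - v))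
    (hinf : (-oo < ereal_inf [set (h y)%:E | y in [set: 'rV[R]_m]])%E)
    (x : 'rV[R]_n) (eps : R) (heps : 0 < eps) :
  (exists z : 'rV[R]_n, prox_linear c h x eps = [set z]) /\
  prox_linear c h x eps = [set x - eps *: g | g in G c h x eps].
Proof.
have [C hC] : exists C : R, forall w, C <= h w.
  have inf_le w : (ereal_inf [set (h y)%:E | y in setT] <= (h w)%:E)%E.
    by apply: ereal_inf_lbound; exists w.
  move: hinf inf_le; case: (ereal_inf _) => [r _ rh| _ /(_ 0)|] //.
  by exists r => w; rewrite -lee_fin.
have [y yP] :=
  dual_solution_exists h (grad c x) (c x) eps C L heps hC hlip hconv.
rewrite (prox_linear_of_subgradient _ _ _ _ _ heps yP).
rewrite (G_of_subgradient _ _ _ _ _ heps yP) image_set1.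
by split=> //; eexists.
Qed.
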